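(* Let $\zeta$ be an ordinal, $(\alpha_\gamma)_{\gamma<\zeta}$ a sequence of ordinals and $G\subseteq\zeta$, and put $\beta=\sum^G_{\gamma<\zeta}\alpha_\gamma$. Then $\beta$ is a mixed sum of $(\alpha_\gamma)_{\gamma<\zeta}$, and it can be realized by some $(A_\gamma)_{\gamma<\zeta}$ such that (1) for every $\varepsilon<\zeta$ the set $\Gamma_\varepsilon=\{\gamma<\zeta\mid \gamma>\varepsilon\text{ and } b<a \text{ for some } b\in A_\gamma \text{ and } a\in A_\varepsilon\}$ is finite, and (2) all but finitely many of the sets $A_\varepsilon$ ($\varepsilon<\zeta$) are convex in the realization.
   Context: All ordinal arithmetic is ordinal arithmetic. The (Hessenberg) natural sum $\alpha\oplus\beta$: write $\alpha=\sum_j\omega^{\eta_j}r_j$, $\beta=\sum_j\omega^{\eta_j}s_j$ in Cantor normal form over a common decreasing finite list of exponents (allowing zero coefficients) and set $\alpha\oplus\beta=\sum_j\omega^{\eta_j}(r_j+s_j)$. For a set $G$ of ordinals, the partial natural sum relative to $G$ is defined by recursion: $\sum^G_{\gamma<0}\alpha_\gamma=0$; $\sum^G_{\gamma<\delta+1}\alpha_\gamma=(\sum^G_{\gamma<\delta}\alpha_\gamma)\oplus\alpha_\delta$ if $\delta\in G$ and $=(\sum^G_{\gamma<\delta}\alpha_\gamma)+\alpha_\delta$ if $\delta\notin G$; supremum of earlier values at limit $\delta$. An ordinal $\beta$ is a mixed sum of $(\alpha_i)_{i\in I}$, realized by $(A_i)_{i\in I}$, if the $A_i$ are pairwise disjoint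 subsets of $\beta$ with $\bigcup_{i\in I}A_i=\beta$ and each $A_i$, with the order induced from $\beta$, has order type $\alpha_i$. In such a realization, $A_{\bar\imath}$ is convex if $\{\beta'<\beta\mid a<\beta'<a'\}\subseteq A_{\bar\imath}$ for all $a<a'$ in $A_{\bar\imath}$. *)

(* Defs.v *)
From HB Require Import structures.
From mathcomp Require Import all_boot all_order.
From mathcomp Require Import boolp classical_sets functions cardinality.

Set Implicit Arguments.
Unset Strict Implicit.
Unset Printing Implicit Defensive.
Import Order.TTheory.
Local Open Scope classical_set_scope.
Local Open Scope quotient_scope.
Local Open Scope order_scope.

(** * Ordinals

    Neither MathComp nor Stdlib has a type of ordinals.  A tree [Node f] stands
    for the ordinal sup_a (f a + 1); ordinals are trees up to equality of the
    ordinals they denote.  [A] ranges over the types of a fixed universe, so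
    [Ord] is the class of all ordinals of that universe. *)

Inductive tree : Type := Node (A : Type) (f : A -> tree).

HB.instance Definition _ := gen_eqMixin tree.
HB.instance Definition _ := gen_choiceMixin tree.

Fixpoint tle (t u : tree) : Prop :=
  let: Node A f := t in let: Node B g := u in
  forall a, exists b, tle (f a) (g b).

Definition tlt (t u : tree) : Prop := let: Node B g := u in exists b, tle t (g b).

Lemma tle_refl t : tle t t.
Proof. by elim: t => A f IH /= a; exists a. Qed.

Lemma tle_trans t u v : tle t u -> tle u v -> tle t v.
Proof.
elim: t u v => A f IH [B g] [C h] /= tu uv a.
by have [b ab] := tu a; have [c bc] := uv b; exists c; apply: IH ab bc.
Qed.

Lemma tleE A (f : A -> tree) u : tle (Node f) u <-> forall a, tlt (f a) u.
Proof. by case: u. Qed.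

Lemma tlt_tleN t u : ~ tle t u -> tlt u t.
Proof.
elim: t u => A f IH [B g] /= /existsNP[a /forallNP na].
by exists a; apply/tleE => b; exact: IH (na b).
Qed.

Lemma tle_lt_trans t u v : tle t u -> tlt u v -> tlt t v.
Proof. by case: v => C h tu [c uc]; exists c; apply: tle_trans tu uc. Qed.

Lemma tlt_le_trans t u v : tlt t u -> tle u v -> tlt t v.
Proof.
case: u v => B g [C h] [b tb] /(_ b)[c bc].
by exists c; apply: tle_trans tb bc.
Qed.

Lemma tltxx t : ~ tlt t t.
Proof.
elim: t => A f IH /= [a] /tleE /(_ a); exact: IH.
Qed.

Lemma tltW t u : tlt t u -> tle t u.
Proof.
elim: t u => A f IH [B g] [b tb].
by apply/tleE => a; exists b; apply: IH; move/tleE: tb; apply.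
Qed.

Lemma tlt_wf : well_founded tlt.
Proof.
suff H u t : tle t u -> Acc tlt t by move=> t; apply: (H t); exact: tle_refl.
elim: u t => B g IH t tu; constructor => s st.
by have [b sb] := tlt_le_trans st tu; apply: IH sb.
Qed.

Definition teqv (t u : tree) : bool := `[< tle t u /\ tle u t >].

Lemma teqv_refl : reflexive teqv.
Proof. by move=> t; apply/asboolP; split; exact: tle_refl. Qed.

Lemma teqv_sym : symmetric teqv.
Proof. by move=> t u; apply/asboolP/asboolP => -[]. Qed.

Lemma teqv_trans : transitive teqv.
Proof.
move=> u t v /asboolP[tu ut] /asboolP[uv vu]; apply/asboolP.
by split; [apply: tle_trans tu uv | apply: tle_trans vu ut].
Qed.

Canonical teqv_equiv := EquivRel teqv teqv_refl teqv_sym teqv_trans.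

Definition Ord := {eq_quot teqv}.
HB.instance Definition _ := Choice.on Ord.
HB.instance Definition _ := EqQuotient.on Ord.

Definition ole (x y : Ord) : bool := `[< tle (repr x) (repr y) >].
Definition olt (x y : Ord) : bool := `[< tlt (repr x) (repr y) >].

Lemma repr_pi_eqv t : tle (repr (\pi_Ord t)) t /\ tle t (repr (\pi_Ord t)).
Proof.
have : teqv (repr (\pi_Ord t)) t by rewrite -eqmodE reprK.
by move/asboolP.
Qed.

Fact olt_def (x y : Ord) : olt x y = (y != x) && ole x y.
Proof.
apply/asboolP/andP => [xy|[yx /asboolP xy]].
- split; last by apply/asboolP; exact: tltW.
  by apply/eqP => yx; move: xy; rewrite yx; exact: tltxx.
- apply: tlt_tleN => yx'; move/eqP: yx; apply.
  by rewrite -(reprK x) -(reprK y); apply/eqmodP/asboolP.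
Qed.

Fact ole_refl : reflexive ole.
Proof. by move=> x; apply/asboolP; exact: tle_refl. Qed.

Fact ole_anti : antisymmetric ole.
Proof.
move=> x y /andP[/asboolP xy /asboolP yx].
by rewrite -(reprK x) -(reprK y); apply/eqmodP/asboolP.
Qed.

Fact ole_trans : transitive ole.
Proof.
by move=> y x z /asboolP xy /asboolP yz; apply/asboolP; apply: tle_trans xy yz.
Qed.

Fact ole_total : total ole.
Proof.
move=> x y; have [xy|xy] := pselect (tle (repr x) (repr y)).
  by rewrite /ole asboolT.
by apply/orP; right; apply/asboolP/tltW/tlt_tleN.
Qed.

Fact Ord_display : Order.disp_t. Proof. exact: Order.Disp tt tt. Qed.

HB.instance Definition _ :=
  Order.isPOrder.Build Ord_display Ord olt_def ole_refl ole_anti ole_trans.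
HB.instance Definition _ := Order.POrder_isTotal.Build Ord_display Ord ole_total.

Lemma Ord_leP (x y : Ord) : reflect (tle (repr x) (repr y)) (x <= y).
Proof. exact: asboolP. Qed.

Lemma Ord_ltP (x y : Ord) : reflect (tlt (repr x) (repr y)) (x < y).
Proof. exact: asboolP. Qed.

Lemma Ord_wf : well_founded (fun x y : Ord => x < y).
Proof.
suff H t (x : Ord) : repr x = t -> Acc (fun x y : Ord => x < y) x.
  by move=> x; apply: H.
elim/(well_founded_ind tlt_wf): t x => t IH x xt; constructor => y /Ord_ltP yx.
by apply: (IH (repr y)) => //; rewrite -xt.
Qed.

Definition below (x : Ord) : set Ord := [set y | y < x].

Lemma family_bounded (A : Type) (F : A -> Ord) : exists u, forall a, F a < u.
Proof.
exists (\pi_Ord (Node (fun a => repr (F a)))) => a; apply/Ord_ltP.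
apply: (@tlt_le_trans _ (Node (fun a => repr (F a)))).
  by exists a; exact: tle_refl.
by case: (repr_pi_eqv (Node (fun a => repr (F a)))).
Qed.

Fixpoint subtree_idx (t : tree) : Type :=
  let: Node A f := t in {a : A & option (subtree_idx (f a))}.

Fixpoint subtree (t : tree) : subtree_idx t -> tree :=
  match t with
  | Node A f => fun p => let: existT a o := p in
      match o with None => f a | Some q => subtree q end
  end.

Lemma tlt_subtree t u : tlt u t -> exists p : subtree_idx t, teqv u (subtree p).
Proof.
elim: t u => A f IH u [a ua].
have [au|/tlt_tleN/IH[p up]] := pselect (tle (f a) u).
  by exists (existT _ a None); apply/asboolP.
by exists (existT _ a (Some p)).
Qed.

Lemma image_below_bounded (F : Ord -> Ord) x : has_ubound (F @` below x).
Proof.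
have [u Fu] := family_bounded (fun p : subtree_idx (repr x) => F (\pi_Ord (subtree p))).
exists u => _ [y /Ord_ltP/tlt_subtree[p yp] <-].
have /eqmodP yE : teqv_equiv (repr y) (subtree p) by [].
by rewrite -(reprK y) yE ltW.
Qed.

Lemma bounded_has_supremum (S : set Ord) : has_ubound S -> supremums S !=set0.
Proof.
case=> u; elim/(well_founded_ind Ord_wf): u => u IH Su.
have [[v [vu Sv]]|nv] := pselect (exists v, v < u /\ ubound S v); first exact: IH vu Sv.
exists u; split=> // v Sv; rewrite leNgt; apply/negP => vu.
by apply: nv; exists v.
Qed.

(** * Zero, successor and transfinite recursion *)

Definition ozero : Ord := \pi_Ord (Node (fun x : False => match x with end)).
Definition osucc (x : Ord) : Ord := \pi_Ord (Node (fun _ : unit => repr x)).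

Lemma ozero_le x : ozero <= x.
Proof.
apply/Ord_leP; case: (repr_pi_eqv (Node (fun x : False => match x with end))) => h _.
by apply: tle_trans h _; apply/tleE.
Qed.

Lemma osucc_leE x y : (osucc x <= y) = (x < y).
Proof.
have [h1 h2] := repr_pi_eqv (Node (fun _ : unit => repr x)).
apply/Ord_leP/Ord_ltP => [xy|xy].
  by have /tleE := tle_trans h2 xy; apply.
by apply: tle_trans h1 _; apply/tleE.
Qed.

Lemma osucc_gt x : x < osucc x.
Proof. by rewrite -osucc_leE. Qed.

Lemma lt_osuccE x y : (x < osucc y) = (x <= y).
Proof. by rewrite ltNge osucc_leE -leNgt. Qed.

Lemma osucc_inj : injective osucc.
Proof.
by move=> x y xy; apply/eqP; rewrite eq_le -!lt_osuccE xy -{1}xy !osucc_gt.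
Qed.

Definition osup (S : set Ord) : Ord := supremum ozero S.

(* The function F with F 0 = z, F (d + 1) = s d (F d) and F d = sup_{c < d} F c
   for limit d; see [trec0], [trecS] and [trec_lim]. *)
Definition trec (z : Ord) (s : Ord -> Ord -> Ord) : Ord -> Ord :=
  Fix Ord_wf (fun _ => Ord) (fun x rec =>
    if x == ozero then z else
    match pselect (exists y, x = osucc y) with
    | left ex =>
        let: exist y xy := cid ex in
        s y (rec y (eq_ind_r (fun w => y < w) (osucc_gt y) xy))
    | right _ => osup [set v | exists y (yx : y < x), v = rec y yx]
    end).

Definition is_limit (x : Ord) : Prop := x <> ozero /\ forall y, x <> osucc y.

Lemma trec_unfold z s x : trec z s x =
  if x == ozero then z else
  match pselect (exists y, x = osucc y) with
  | left ex => let: exist y _ := cid ex in s y (trec z s y)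
  | right _ => osup [set v | exists y (_ : y < x), v = trec z s y]
  end.
Proof.
rewrite {1}/trec Fix_eq; first by case: ifP => // _; case: pselect => // ex; case: cid.
move=> y f g fg; case: ifP => // _; case: pselect => [ex|_].
  by case: cid => w yw; rewrite fg.
congr osup; rewrite predeqE => v; split=> -[w [wy ->]]; exists w, wy.
  exact: fg.
exact/esym/fg.
Qed.

Lemma trec0 z s : trec z s ozero = z.
Proof. by rewrite trec_unfold eqxx. Qed.

Lemma trecS z s x : trec z s (osucc x) = s x (trec z s x).
Proof.
rewrite trec_unfold ifF; last first.
  by apply/negP => /eqP x0; have := osucc_gt x; rewrite x0 ltNge ozero_le.
case: pselect => [ex|]; last by case; exists x.
by case: cid => y /osucc_inj ->.
Qed.

Lemma trec_lim z s x : is_limit x -> trec z s x = osup (trec z s @` below x).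
Proof.
case=> x0 xS; rewrite trec_unfold ifF; last by apply/eqP.
case: pselect => [[y /xS//]|_]; congr osup; rewrite predeqE => v; split.
  by move=> [y [yx ->]]; exists y.
by move=> [y yx <-]; exists y, yx.
Qed.

(** * Ordinal arithmetic *)

Definition onat (n : nat) : Ord := iter n osucc ozero.
Definition omega : Ord := osup (range onat).

Definition oadd (x y : Ord) : Ord := trec x (fun _ v => osucc v) y.
Definition omul (x y : Ord) : Ord := trec ozero (fun _ v => oadd v x) y.
Definition omega_pow (e : Ord) : Ord := trec (onat 1) (fun _ v => omul v omega) e.

(* omega^e_0 n_0 + omega^e_1 n_1 + ... for [s] = (e_0, n_0), (e_1, n_1), ... *)
Definition cnf_val (s : seq (Ord * nat)) : Ord :=
  \big[oadd/ozero]_(p <- s) omul (omega_pow p.1) (onat p.2).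

(* The entries of [s] are (exponent, coefficient in x, coefficient in y). *)
Definition is_natural_sum (x y v : Ord) : Prop :=
  exists s : seq (Ord * nat * nat),
    [/\ sorted >%O [seq p.1.1 | p <- s],
        x = cnf_val [seq (p.1.1, p.1.2) | p <- s],
        y = cnf_val [seq (p.1.1, p.2) | p <- s] &
        v = cnf_val [seq (p.1.1, (p.1.2 + p.2)%N) | p <- s]].

(* By the Cantor normal form theorem, exactly one [v] satisfies
   [is_natural_sum x y v], so the default value is never used. *)
Definition natural_sum (x y : Ord) : Ord := xget ozero (is_natural_sum x y).

(* Only the values of [alpha] at arguments below [z] matter. *)
Definition partial_natural_sum (G : set Ord) (alpha : Ord -> Ord) (z : Ord) : Ord :=
  trec ozero (fun d v => if `[< G d >] then natural_sum v (alpha d)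
                         else oadd v (alpha d)) z.

(** * Mixed sums *)

Definition has_order_type (A : set Ord) (x : Ord) : Prop :=
  exists f : Ord -> Ord, set_bij (below x) A f /\
    forall c d, below x c -> below x d -> c < d -> f c < f d.

Definition realizes (I : Type) (D : set I) (alpha : I -> Ord) (beta : Ord)
    (A : I -> set Ord) : Prop :=
  [/\ trivIset D A, \bigcup_(i in D) A i = below beta &
      forall i, D i -> has_order_type (A i) (alpha i)].

Definition mixed_sum (I : Type) (D : set I) (alpha : I -> Ord) (beta : Ord) : Prop :=
  exists A : I -> set Ord, realizes D alpha beta A.

Definition convex_in (beta : Ord) (A : set Ord) : Prop :=
  forall a a', A a -> A a' -> a < a' ->
    [set b | b < beta /\ a < b < a'] `<=` A.

(* Main.v *)
Require Import Defs.
From mathcomp Require Import all_boot all_order.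
From mathcomp Require Import boolp classical_sets functions cardinality.
Local Open Scope classical_set_scope.
Local Open Scope order_scope.

(** Let [S] be the partial natural sums and [T] the ordinary partial sums.  At a
    limit [d], choose [c < d] minimizing the ordinal [r] with [T d = T c + r].
    Minimality makes [r] zero or additively indecomposable, i.e. of the form [omega^e].
    If every [T b - T c] stays below [omega^e], then so does [S b - S c], because
    [alpha < omega^e] implies that [x (+) alpha < x + omega^e] (where [(+)] is
    the natural sum).  Hence [S d <= S c + omega^e], which is also the value
    obtained from [S c] by adding the remaining terms with ordinary sums (for
    [r = 0] all these sums are constant from [c] on): every limit stage is an
    earlier stage followed by ordinary additions, which contribute convex pieces.  It
    remains to treat single natural sums [x (+) y].  Cantor normal forms cut [x]
    into finitely many blocks between which the blocks of [y] are inserted, and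
    each cut destroys the convexity of at most one convex piece of [x]. *)

Set Implicit Arguments.
Unset Strict Implicit.
Unset Printing Implicit Defensive.
Import Order.TTheory.

(** * Ordinal addition *)

Lemma ord_ind (P : Ord -> Prop) :
  (forall x, (forall y, y < x -> P y) -> P x) -> forall x, P x.
Proof. exact: well_founded_ind Ord_wf P. Qed.

Lemma ord_least (P : Ord -> Prop) :
  (exists x, P x) -> exists x, P x /\ forall y, P y -> x <= y.
Proof.
case=> x; elim/ord_ind: x => x IH Px.
have [[y [yx Py]]|ny] := pselect (exists y, y < x /\ P y); first exact: IH yx Py.
by exists x; split=> // y Py; rewrite leNgt; apply/negP => yx; apply: ny; exists y.
Qed.

Lemma ozeroP x : (x <= ozero) = (x == ozero).
Proof. by rewrite eq_le ozero_le andbT. Qed.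

Lemma osucc_le x y : (osucc x <= osucc y) = (x <= y).
Proof. by rewrite osucc_leE lt_osuccE. Qed.

Lemma ord_zsl x : [\/ x = ozero, exists y, x = osucc y | is_limit x].
Proof.
have [->|x0] := eqVneq x ozero; first exact: Or31.
have [xs|xs] := pselect (exists y, x = osucc y); first exact: Or32.
by apply: Or33; split=> [|y xy]; [exact/eqP | apply: xs; exists y].
Qed.

Lemma limit_gt0 x : is_limit x -> ozero < x.
Proof. by case=> /eqP x0 _; rewrite lt_neqAle eq_sym x0 ozero_le. Qed.

Lemma osup_supremum (S : set Ord) :
  S !=set0 -> has_ubound S -> supremums S (osup S).
Proof.
move=> [y Sy] /bounded_has_supremum[u Su]; rewrite /osup /supremum.
by case: eqP Sy => [->//|_ _]; case: xgetP => [//|/(_ u)].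
Qed.

Lemma trec_lim_supremum z s d :
  is_limit d -> supremums (trec z s @` below d) (trec z s d).
Proof.
move=> dl; rewrite trec_lim//; apply: osup_supremum; last exact: image_below_bounded.
by exists (trec z s ozero), ozero => //; exact: limit_gt0.
Qed.

Lemma trec_lim_le z s d u : is_limit d ->
  (forall c, c < d -> trec z s c <= u) -> trec z s d <= u.
Proof.
by move=> /(trec_lim_supremum z s)[_ lub] cu; apply: lub => _ [c cd <-]; exact: cu.
Qed.

Lemma trec_homo z s : (forall d v, v <= s d v) ->
  {homo trec z s : x y / x <= y}.
Proof.
move=> sle x y; elim/ord_ind: y => y IH.
rewrite le_eqVlt => /predU1P[->//|xy].
case: (ord_zsl y) => [y0|[w yw]|yl].
- by move: xy; rewrite y0 ltNge ozero_le.
- rewrite yw trecS; apply: le_trans (sle _ _).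
  by apply: IH; [rewrite yw osucc_gt | rewrite -lt_osuccE -yw].
- by have [ub _] := trec_lim_supremum z s yl; apply: ub; exists x.
Qed.

Lemma trec_ext z s s' d : (forall c, c < d -> s c = s' c) ->
  trec z s d = trec z s' d.
Proof.
elim/ord_ind: d => d IH ss; case: (ord_zsl d) => [->|[c dc]|dl].
- by rewrite !trec0.
- subst d; rewrite !trecS ss ?osucc_gt// IH ?osucc_gt// => b bc.
  by apply: ss; exact: lt_trans bc (osucc_gt c).
- rewrite !trec_lim//; congr osup; apply: eq_imagel => c cd.
  by apply: IH => // b bc; apply: ss; exact: lt_trans bc cd.
Qed.

Lemma oadd0 x : oadd x ozero = x.
Proof. exact: trec0. Qed.

Lemma oaddS x y : oadd x (osucc y) = osucc (oadd x y).
Proof. exact: trecS. Qed.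

Lemma oadd_lim_le x y u : is_limit y ->
  (forall c, c < y -> oadd x c <= u) -> oadd x y <= u.
Proof. exact: trec_lim_le. Qed.

Lemma oadd_homo x : {homo oadd x : y z / y <= z}.
Proof. by apply: trec_homo => _ v; exact/ltW/osucc_gt. Qed.

Lemma ltoD2l x y z : (oadd x y < oadd x z) = (y < z).
Proof.
apply/idP/idP => [|yz]; first by apply: contraTT; rewrite -!leNgt; exact: oadd_homo.
by rewrite -osucc_leE -oaddS; apply: oadd_homo; rewrite osucc_leE.
Qed.

Lemma leoD2l x y z : (oadd x y <= oadd x z) = (y <= z).
Proof. by rewrite !leNgt ltoD2l. Qed.

Lemma oaddI x : injective (oadd x).
Proof.
by move=> y z yz; apply/eqP; rewrite eq_le -(leoD2l x y) -(leoD2l x z) yz lexx.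
Qed.

Lemma leo_addr x y : x <= oadd x y.
Proof. by rewrite -{1}(oadd0 x) leoD2l ozero_le. Qed.

Lemma leo_addl x y : y <= oadd x y.
Proof.
(* A least [y] with [x + y < y] is impossible: adding [x] on the left makes [x + y] a smaller
   one. *)
apply: contrapT => /negP; rewrite -ltNge => lt.
have [z [zlt zmin]] := ord_least (ex_intro (fun y => oadd x y < y) y lt).
have := zmin (oadd x z); rewrite ltoD2l => /(_ zlt).
by rewrite leNgt zlt.
Qed.

Lemma oadd_subP x z : x <= z -> exists y, z = oadd x y.
Proof.
move=> xz.
(* Take the least [y] with [z <= x + y]; at a successor or a limit, [z < x + y] would contradict
   minimality. *)
have [y [zy ymin]] := ord_least (ex_intro (fun y => z <= oadd x y) z (leo_addl x z)).
exists y; apply/le_anti; rewrite zy/=.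
case: (ord_zsl y) => [->|[w yw]|yl].
- by rewrite oadd0.
- rewrite yw oaddS osucc_leE ltNge; apply/negP => /ymin.
  by rewrite yw osucc_leE ltxx.
- apply: oadd_lim_le => // c cy; rewrite leNgt; apply/negP => /ltW/ymin.
  by rewrite leNgt cy.
Qed.

Lemma oadd_ltP x y z : x <= z -> z < oadd x y -> exists2 w, w < y & z = oadd x w.
Proof. by move=> /oadd_subP[w ->]; rewrite ltoD2l => wy; exists w. Qed.

Lemma oaddA : associative oadd.
Proof.
move=> x y z; elim/ord_ind: z => z IH; case: (ord_zsl z) => [->|[w zw]|zl].
- by rewrite !oadd0.
- by rewrite zw !oaddS IH// zw osucc_gt.
apply/le_anti/andP; split; last first.
  by apply: oadd_lim_le => // c cz; rewrite -IH// !leoD2l ltW.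
rewrite leNgt; apply/negP.
(* Otherwise [(x + y) + z = x + w] with [w < y + z] and [w = y + c] with [c < z]; by induction this
   is [(x + y) + c], which is too small. *)
move=> lt; have [|w wyz E] := @oadd_ltP x (oadd y z) (oadd (oadd x y) z) _ lt.
  by rewrite (le_trans (leo_addr x y)) ?leo_addr.
have yw : y <= w by rewrite -(leoD2l x) -E leo_addr.
have [c cz wE] := oadd_ltP yw wyz.
have : oadd (oadd x y) c < oadd (oadd x y) z by rewrite ltoD2l.
by rewrite E wE -IH// ltxx.
Qed.

Lemma add0o : left_id ozero oadd.
Proof.
move=> x; elim/ord_ind: x => x IH; case: (ord_zsl x) => [->|[w xw]|xl].
- by rewrite oadd0.
- by rewrite xw oaddS IH// xw osucc_gt.
apply/le_anti; rewrite leo_addl andbT.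
by apply: oadd_lim_le => // c cx; rewrite IH// ltW.
Qed.

(** * Powers of omega and Cantor normal forms *)

Lemma leoD2r x y z : x <= y -> oadd x z <= oadd y z.
Proof.
move=> xy; elim/ord_ind: z => z IH; case: (ord_zsl z) => [->|[w zw]|zl].
- by rewrite !oadd0.
- by rewrite zw !oaddS osucc_le IH// zw osucc_gt.
apply: oadd_lim_le => // c cz; apply: le_trans (IH _ cz) _.
by rewrite leoD2l ltW.
Qed.

Lemma onatS n : onat n.+1 = osucc (onat n).
Proof. by []. Qed.

Lemma omega_supremum : supremums (range onat) omega.
Proof.
apply: osup_supremum; first by exists ozero; exists 0%N.
have [u nu] := family_bounded onat.
by exists u => _ [n _ <-]; exact/ltW.
Qed.

Lemma onat_lt_omega n : onat n < omega.
Proof.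
have [ub _] := omega_supremum.
by apply: lt_le_trans (osucc_gt _) _; apply: ub; exists n.+1.
Qed.

Lemma lt_omegaP x : x < omega -> exists n, x < onat n.
Proof.
move=> xw; apply: contrapT => /forallNP nx.
have [_ lub] := omega_supremum; move: xw; rewrite ltNge => /negP; apply.
by apply: lub => _ [n _ <-]; rewrite leNgt; apply/negP.
Qed.

Lemma omega_limit : is_limit omega.
Proof.
split=> [w0|y wy]; first by have := onat_lt_omega 0; rewrite w0 ltxx.
have [n yn] : exists n, y < onat n by apply: lt_omegaP; rewrite wy osucc_gt.
by have := onat_lt_omega n; rewrite wy ltNge osucc_leE yn.
Qed.

Lemma omul0 x : omul x (onat 0) = ozero.
Proof. exact: trec0. Qed.

Lemma omulS x n : omul x (onat n.+1) = oadd (omul x (onat n)) x.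
Proof. by rewrite onatS /omul trecS. Qed.

Lemma omulD x m n :
  omul x (onat (m + n)%N) = oadd (omul x (onat m)) (omul x (onat n)).
Proof.
elim: n => [|n IH]; first by rewrite addn0 omul0 oadd0.
by rewrite addnS !omulS IH oaddA.
Qed.

Lemma omul1 x : omul x (onat 1) = x.
Proof. by rewrite omulS omul0 add0o. Qed.

Lemma omul_homo x : {homo omul x : y z / y <= z}.
Proof. by apply: trec_homo => _ v; exact: leo_addr. Qed.

Lemma lt_omul_omegaP x y :
  y < omul x omega -> exists n, y < omul x (onat n).
Proof.
move=> yx; apply: contrapT => /forallNP ny; move: yx; rewrite ltNge => /negP; apply.
apply: trec_lim_le; first exact: omega_limit.
move=> c /lt_omegaP[n /ltW cn]; apply: le_trans (omul_homo x cn) _.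
by rewrite leNgt; apply/negP.
Qed.

Lemma omega_pow0 : omega_pow ozero = onat 1.
Proof. exact: trec0. Qed.

Lemma omega_powS e : omega_pow (osucc e) = omul (omega_pow e) omega.
Proof. exact: trecS. Qed.

Lemma omega_pow_homo : {homo omega_pow : x y / x <= y}.
Proof.
apply: trec_homo => _ v; rewrite -{1}(omul1 v).
exact/omul_homo/ltW/onat_lt_omega.
Qed.

Lemma omega_pow_gt0 e : ozero < omega_pow e.
Proof.
apply: (@lt_le_trans _ _ (omega_pow ozero)); last exact/omega_pow_homo/ozero_le.
by rewrite omega_pow0 osucc_gt.
Qed.

Lemma oaddx_gt x y : ozero < y -> x < oadd x y.
Proof. by move=> y0; rewrite -{1}(oadd0 x) ltoD2l. Qed.

Lemma omega_powS_omul e n : omul (omega_pow e) (onat n) < omega_pow (osucc e).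
Proof.
apply: (@lt_le_trans _ _ (omul (omega_pow e) (onat n.+1))).
  by rewrite omulS oaddx_gt ?omega_pow_gt0.
by rewrite omega_powS; exact/omul_homo/ltW/onat_lt_omega.
Qed.

Lemma omega_pow_lt : {mono omega_pow : x y / x < y}.
Proof.
move=> x y; apply/idP/idP => [|xy].
  by apply: contraTT; rewrite -!leNgt; exact: omega_pow_homo.
apply: (@lt_le_trans _ _ (omega_pow (osucc x))); last first.
  by apply: omega_pow_homo; rewrite osucc_leE.
by have := omega_powS_omul x 1; rewrite omul1.
Qed.

Lemma omega_pow_lim_lt e x : is_limit e -> x < omega_pow e ->
  exists2 c, c < e & x < omega_pow c.
Proof.
move=> el xe; apply: contrapT => nc; move: xe; rewrite ltNge => /negP; apply.
apply: trec_lim_le => // c ce; rewrite leNgt; apply/negP => xc.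
by apply: nc; exists c.
Qed.

(** Induction on [e]. At a successor, finite multiples of the previous power add up to a finite
    multiple; at a limit, both terms lie below one earlier power. *)
Lemma omega_pow_add_lt e x y :
  x < omega_pow e -> y < omega_pow e -> oadd x y < omega_pow e.
Proof.
elim/ord_ind: e x y => e IH x y; case: (ord_zsl e) => [->|[w ew]|el].
- by rewrite omega_pow0 !lt_osuccE !ozeroP => /eqP -> /eqP ->; rewrite oadd0.
- rewrite ew omega_powS => /lt_omul_omegaP[m xm] /lt_omul_omegaP[n yn].
  rewrite -omega_powS; apply: le_lt_trans (omega_powS_omul w (m + n)).
  rewrite omulD; apply: le_trans (leoD2r _ (ltW xm)) _.
  by rewrite leoD2l ltW.
- move=> /(omega_pow_lim_lt el)[c ce xc] /(omega_pow_lim_lt el)[d de yd].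
  have [cd|/ltW dc] := leP c d.
    apply: lt_trans (IH d de _ _ _ yd) _; last by rewrite omega_pow_lt.
    exact: lt_le_trans xc (omega_pow_homo cd).
  apply: lt_trans (IH c ce _ _ xc _) _; last by rewrite omega_pow_lt.
  exact: lt_le_trans yd (omega_pow_homo dc).
Qed.

(** If the sum were larger, [omega^e] would be [x + y] with [y < omega^e], against closure under
    addition. *)
Lemma omega_pow_absorb e x : x < omega_pow e -> oadd x (omega_pow e) = omega_pow e.
Proof.
move=> xe; apply/le_anti; rewrite leo_addl andbT leNgt; apply/negP => lt.
have [y ye E] := oadd_ltP (ltW xe) lt.
by have := omega_pow_add_lt xe ye; rewrite -E ltxx.
Qed.

Lemma omul_omega_pow_lt e d n : e < d -> omul (omega_pow e) (onat n) < omega_pow d.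
Proof.
move=> ed; apply: lt_le_trans (omega_powS_omul e n) _.
by apply: omega_pow_homo; rewrite osucc_leE.
Qed.

Lemma omega_pow_ge e : e <= omega_pow e.
Proof.
apply: contrapT => /negP; rewrite -ltNge => lt.
have [z [zlt zmin]] := ord_least (ex_intro (fun e => omega_pow e < e) e lt).
have := zmin (omega_pow z); rewrite omega_pow_lt => /(_ zlt).
by rewrite leNgt zlt.
Qed.

(** The least [e] with [x < omega^e] is neither zero nor a limit; its predecessor is the leading
    exponent. *)
Lemma omega_log x : ozero < x ->
  exists e, omega_pow e <= x /\ x < omega_pow (osucc e).
Proof.
move=> x0.
have [|e [xe emin]] := @ord_least (fun e => x < omega_pow e).
  by exists (osucc x); apply: lt_le_trans (omega_pow_ge _); exact: osucc_gt.
case: (ord_zsl e) => [e0|[w ew]|el].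
- by move: xe; rewrite e0 omega_pow0 ltNge osucc_leE x0.
- exists w; rewrite -ew xe leNgt; split=> //; apply/negP => /emin.
  by rewrite ew osucc_leE ltxx.
- by have [c ce /emin] := omega_pow_lim_lt el xe; rewrite leNgt ce.
Qed.

Lemma omega_pow_divP e x : x < omega_pow (osucc e) ->
  exists n y, y < omega_pow e /\ x = oadd (omul (omega_pow e) (onat n)) y.
Proof.
rewrite omega_powS => /lt_omul_omegaP[n]; elim: n => [|n IH].
  by rewrite omul0 ltNge ozero_le.
rewrite omulS; have [/IH//|nx] := ltP x (omul (omega_pow e) (onat n)).
by move=> /(oadd_ltP nx)[y ye ->]; exists n, y.
Qed.

Lemma cnf_val_cons p s :
  cnf_val (p :: s) = oadd (omul (omega_pow p.1) (onat p.2)) (cnf_val s).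
Proof. by rewrite /cnf_val big_cons. Qed.

Lemma cnf_val_nil : cnf_val [::] = ozero.
Proof. by rewrite /cnf_val big_nil. Qed.

Lemma cnf_val_lt s e :
  all (fun p => p.1 < e) s -> cnf_val s < omega_pow e.
Proof.
elim: s => [|p s IH] /=; first by rewrite cnf_val_nil omega_pow_gt0.
move=> /andP[pe /IH se]; rewrite cnf_val_cons.
by apply: omega_pow_add_lt se; exact: omul_omega_pow_lt.
Qed.

(** The larger of [x] and [y] gives the leading exponent [d]. Both are divided by [omega^d],
    possibly with one coefficient zero, and induction treats the remainders below [omega^d]. *)
Lemma common_cnf e x y : x < omega_pow e -> y < omega_pow e ->
  exists s : seq (Ord * nat * nat),
    [/\ path >%O e [seq p.1.1 | p <- s],
        x = cnf_val [seq (p.1.1, p.1.2) | p <- s] &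
        y = cnf_val [seq (p.1.1, p.2) | p <- s]].
Proof.
elim/ord_ind: e x y => e IH x y xe ye.
have [z0|z0] := eqVneq (Order.max x y) ozero.
  exists [::]; rewrite /= cnf_val_nil; split=> //; apply/eqP; rewrite -ozeroP -z0.
    by rewrite le_max lexx.
  by rewrite le_max lexx orbT.
have [|d [dz zd]] := @omega_log (Order.max x y).
  by rewrite lt_neqAle eq_sym z0 ozero_le.
have de : d < e.
  by rewrite -omega_pow_lt; apply: le_lt_trans dz _; rewrite gt_max xe.
move: zd; rewrite gt_max => /andP[].
move=> /omega_pow_divP[m [x' [x'd ->]]] /omega_pow_divP[n [y' [y'd ->]]].
have [s [sd -> ->]] := IH d de _ _ x'd y'd.
by exists ((d, m, n) :: s); split; rewrite /= ?cnf_val_cons//= de.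
Qed.

(** * Existence and size of natural sums *)

Lemma natural_sumP x y : is_natural_sum x y (natural_sum x y).
Proof.
apply: xgetPex.
have lt z : z <= Order.max x y -> z < omega_pow (osucc (Order.max x y)).
  by rewrite -lt_osuccE => /lt_le_trans; apply; exact: omega_pow_ge.
have [||s [/path_sorted ss xE yE]] := @common_cnf (osucc (Order.max x y)) x y.
- by apply: lt; rewrite le_max lexx.
- by apply: lt; rewrite le_max lexx orbT.
by exists (cnf_val [seq (p.1.1, (p.1.2 + p.2)%N) | p <- s]), s.
Qed.

Lemma sorted_cnf_lt (T : eqType) (f : T -> Ord * nat) (e : Ord) s :
  path >%O e [seq (f p).1 | p <- s] -> cnf_val (map f s) < omega_pow e.
Proof.
move=> es; apply: cnf_val_lt; rewrite all_map.
move: es; rewrite path_sortedE; last by move=> a b c ba cb; exact: lt_trans cb ba.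
by rewrite all_map => /andP[].
Qed.

(** Term by term: if [y] has a nonzero coefficient at [e], its [omega^e] absorbs the tail of [x] in
    the ordinary sum, while the natural sum keeps that tail. *)
Lemma natsum_ge x y v : is_natural_sum x y v -> oadd x y <= v.
Proof.
case=> s [+ -> -> ->]; elim: s => [|[[e m] n] s IH] /=.
  by rewrite !cnf_val_nil oadd0.
rewrite !cnf_val_cons/= => es; have /IH {}IH := path_sorted es.
rewrite omulD -!oaddA leoD2l; case: n => [|n].
  by rewrite omul0 !add0o.
rewrite -(add1n n) omulD omul1 -!oaddA (oaddA (cnf_val _)) omega_pow_absorb; last first.
  exact: (@sorted_cnf_lt _ (fun p => (p.1.1, p.1.2))).
rewrite !leoD2l; exact: le_trans (leo_addl _ _) IH.
Qed.

(** Leading terms absent from [y] are common to both sides. From the first term present in [y] on,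
    all exponents are below [e], so the rest of [v] is below [omega^e]. *)
Lemma natsum_lt x y v e : is_natural_sum x y v -> y < omega_pow e ->
  v < oadd x (omega_pow e).
Proof.
case=> s [+ -> -> ->]; elim: s => [|[[d m] n] s IH] /=.
  by rewrite !cnf_val_nil add0o.
rewrite !cnf_val_cons/= => ds; have /IH {}IH := path_sorted ds.
case: n => [|n].
  by rewrite omul0 add0o addn0 => /IH ve; rewrite -oaddA ltoD2l.
move=> ye; have de : d < e.
  rewrite -omega_pow_lt; apply: le_lt_trans ye; rewrite omulS -oaddA.
  by apply: le_trans (leo_addl _ _); exact: leo_addr.
apply: lt_le_trans (leo_addl _ _); apply: omega_pow_add_lt.
  exact: omul_omega_pow_lt.
apply: lt_trans (_ : omega_pow d < _); last by rewrite omega_pow_lt.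
exact: (@sorted_cnf_lt _ (fun p => (p.1.1, (p.1.2 + p.2)%N))).
Qed.

(** * Growth of partial sums *)

(* The properties shared by the partial sums relative to all sets [G], for a
   fixed [alpha]; any two such sequences grow at the same rate, see
   [sumlike_growth]. *)
Record sumlike (alpha S : Ord -> Ord) : Prop := Sumlike {
  sumlike_homo : {homo S : c d / c <= d};
  sumlike_lim : forall d u, is_limit d -> (forall c, c < d -> S c <= u) -> S d <= u;
  sumlike_ge : forall d, oadd (S d) (alpha d) <= S (osucc d);
  sumlike_lt : forall d e, alpha d < omega_pow e ->
    S (osucc d) < oadd (S d) (omega_pow e) }.

Lemma pns0 G alpha : partial_natural_sum G alpha ozero = ozero.
Proof. exact: trec0. Qed.

Lemma pnsS G alpha d : partial_natural_sum G alpha (osucc d) =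
  if `[< G d >] then natural_sum (partial_natural_sum G alpha d) (alpha d)
  else oadd (partial_natural_sum G alpha d) (alpha d).
Proof. exact: trecS. Qed.

Lemma natural_sum_ge x y : oadd x y <= natural_sum x y.
Proof. exact/natsum_ge/natural_sumP. Qed.

Lemma pns_sumlike G alpha : sumlike alpha (partial_natural_sum G alpha).
Proof.
split=> [|d u dl cu|d|d e de].
- apply: trec_homo => d v; case: ifP => _; last exact: leo_addr.
  exact: le_trans (leo_addr _ _) (natural_sum_ge _ _).
- exact: trec_lim_le.
- by rewrite pnsS; case: ifP => _ //; exact: natural_sum_ge.
- rewrite pnsS; case: ifP => _; last by rewrite ltoD2l.
  exact: natsum_lt (natural_sumP _ _) de.
Qed.

(** Let [omega^e] be the leading power of [r]. If it were less than [r], iterating the hypothesis at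
    [omega^e] would put all its finite multiples below or at [r], against [r < omega^(e+1)]. *)
Lemma indecomposable_omega_pow r : ozero < r ->
  (forall x, x < r -> oadd x r <= r) -> exists e, r = omega_pow e.
Proof.
move=> /omega_log[e [er re]] rI; exists e; apply/le_anti; rewrite er andbT.
rewrite leNgt; apply/negP => /rI err.
have nr n : oadd (omul (omega_pow e) (onat n)) r <= r.
  elim: n => [|n IH]; first by rewrite omul0 add0o.
  by rewrite omulS -oaddA; apply: le_trans IH; rewrite leoD2l.
move: re; rewrite omega_powS => /lt_omul_omegaP[n].
by rewrite ltNge (le_trans (leo_addr _ r) (nr n)).
Qed.

Lemma limit_remainder alpha T d c : sumlike alpha T -> is_limit d -> c < d ->
  exists b, [/\ c <= b, b < d & T d = T b \/
    (forall a, a < d -> T a < T d) /\ exists e, T d = oadd (T b) (omega_pow e)].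
Proof.
move=> [Thomo Tlim _ _] dl cd.
pose P r := exists b, [/\ c <= b, b < d & T d = oadd (T b) r].
have rem b : b < d -> exists r, T d = oadd (T b) r.
  by move=> bd; apply: oadd_subP; exact/Thomo/ltW.
have [|r [[b [cb bd rE]] rmin]] := @ord_least P.
  by have [r rE] := rem c cd; exists r, c.
have {}rmin a : b <= a -> a < d -> exists2 r', r <= r' & T d = oadd (T a) r'.
  move=> ba ad; have [r' r'E] := rem a ad; exists r' => //.
  by apply: rmin; exists a; split=> //; exact: le_trans cb ba.
exists b; split=> //.
have [r0|r0] := eqVneq r ozero; first by left; rewrite rE r0 oadd0.
have {r0} r0 : ozero < r by rewrite lt_neqAle eq_sym r0 ozero_le.
(* From [b] on every remainder is at least [r > 0], so [T] does not reach [T d] before [d]. *)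
right; split=> [a ad|].
  apply: (@le_lt_trans _ _ (T (Order.max a b))).
    by apply: Thomo; rewrite le_max lexx.
  have [|| r' rr' ->] := rmin (Order.max a b); first by rewrite le_max lexx orbT.
    by rewrite gt_max ad.
  by apply: oaddx_gt; exact: lt_le_trans r0 rr'.
have [x xr|e re] := indecomposable_omega_pow r0; last by exists e; rewrite rE re.
(* By continuity some [T a = T b + y] has [y > x]. Then [r = y + r'] with [r <= r'], whence
   [x + r <= y + r' = r]. *)
have [a ad xa] : exists2 a, a < d & oadd (T b) x < T a.
  apply: contrapT => na; have : T d <= oadd (T b) x.
    apply: Tlim => // a ad; rewrite leNgt; apply/negP => xa; apply: na.
    by exists a.
  by rewrite rE leoD2l leNgt xr.
have ba : b <= a.
  rewrite leNgt; apply/negP => /ltW/Thomo ab.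
  by have := le_lt_trans (leo_addr _ _) (lt_le_trans xa ab); rewrite ltxx.
have [y yE] := oadd_subP (Thomo _ _ ba).
move: xa; rewrite yE ltoD2l => xy.
have [r' rr'] := rmin a ba ad; rewrite rE yE -oaddA => /oaddI r'E.
by rewrite {2}r'E; apply: le_trans (leoD2r _ (ltW xy)) _; rewrite leoD2l.
Qed.

(** Used at limits: a further increment [omega^d] with [d < e] stays in the window of width
    [omega^e] above [x]. *)
Lemma ltoD_omega_pow x y z e d : y < oadd x (omega_pow e) -> x <= y ->
  z <= oadd y (omega_pow d) -> d < e -> z < oadd x (omega_pow e).
Proof.
move=> /[swap] xy /(oadd_ltP xy)[w we ->] zw de; apply: le_lt_trans zw _.
by rewrite -oaddA ltoD2l; apply: omega_pow_add_lt; rewrite ?omega_pow_lt.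
Qed.

(** Induction on [d]. At a successor the last term is below [omega^e] and is absorbed; at a limit
    [limit_remainder] leads to a smaller exponent or to constancy. *)
Lemma sumlike_growth alpha S T c d e : sumlike alpha S -> sumlike alpha T ->
  c <= d -> T d < oadd (T c) (omega_pow e) -> S d < oadd (S c) (omega_pow e).
Proof.
move=> sS sT; have [Shomo Slim _ Slt] := sS; have [Thomo Tlim Tge _] := sT.
elim/ord_ind: d c e => d IH c e; rewrite le_eqVlt => /predU1P[<- _|cd Td].
  exact/oaddx_gt/omega_pow_gt0.
case: (ord_zsl d) => [d0|[b db]|dl].
- by move: cd; rewrite d0 ltNge ozero_le.
- have cb : c <= b by rewrite -lt_osuccE -db.
  have bd : b < d by rewrite db osucc_gt.
  have Sb : S b < oadd (S c) (omega_pow e).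
    by apply: IH => //; apply: le_lt_trans Td; exact/Thomo/ltW.
  (* [T] itself grew by at least [alpha b] inside the window. *)
  have ab : alpha b < omega_pow e.
    rewrite -(ltoD2l (T c)); apply: le_lt_trans Td.
    by rewrite db; apply: le_trans (Tge b); exact/leoD2r/Thomo.
  rewrite db; apply: lt_le_trans (Slt b e ab) _.
  have [w we ->] := oadd_ltP (Shomo _ _ cb) Sb.
  by rewrite -oaddA omega_pow_absorb.
- have [b [cb bd Tb]] := limit_remainder sT dl cd.
  have Sb : S b < oadd (S c) (omega_pow e).
    by apply: IH => //; apply: le_lt_trans Td; exact/Thomo/ltW.
  case: Tb => [Tb|[Ta [e' Tb]]].
    apply: le_lt_trans Sb; apply: Slim => // a ad.
    have [ab|/ltW ba] := leP a b; first exact: Shomo.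
    (* Constancy is growth below [omega^0 = 1], so exponent zero transfers it from [T] to [S]. *)
    have := IH a ad b ozero ba; rewrite omega_pow0 !oaddS !oadd0 !lt_osuccE -Tb.
    by apply; exact/Thomo/ltW.
  have e'e : e' < e.
    rewrite -omega_pow_lt -(ltoD2l (T c)); apply: le_lt_trans Td.
    by rewrite Tb; exact/leoD2r/Thomo.
  apply: ltoD_omega_pow Sb (Shomo _ _ cb) _ e'e; apply: Slim => // a ad.
  have [ab|/ltW ba] := leP a b; first by apply: le_trans (leo_addr _ _); exact: Shomo.
  by apply/ltW/IH => //; rewrite -Tb; exact: Ta.
Qed.

(** * Dependence on [G] and limit stages *)

Lemma pns_ext G G' alpha c : (forall b, b < c -> G b <-> G' b) ->
  partial_natural_sum G alpha c = partial_natural_sum G' alpha c.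
Proof. by move=> GG; apply: trec_ext => b /GG /propext ->. Qed.

Lemma pns_below G alpha c :
  partial_natural_sum (G `&` below c) alpha c = partial_natural_sum G alpha c.
Proof. by apply: pns_ext => b bc; split=> [[]//|Gb]; split. Qed.

(** From [c] on, the sums for [G'] make only ordinary additions, the smallest steps that
    [sumlike_ge] permits. *)
Lemma pns_tail_le G G' alpha c d : (forall b, c <= b -> ~ G' b) ->
  partial_natural_sum G' alpha c <= partial_natural_sum G alpha c ->
  c <= d -> partial_natural_sum G' alpha d <= partial_natural_sum G alpha d.
Proof.
move=> nG' cle; have [Shomo _ Sge _] := pns_sumlike G alpha.
have [Uhomo Ulim _ _] := pns_sumlike G' alpha.
elim/ord_ind: d => d IH; rewrite le_eqVlt => /predU1P[<-//|cd].
case: (ord_zsl d) => [d0|[b db]|dl].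
- by move: cd; rewrite d0 ltNge ozero_le.
- have cb : c <= b by rewrite -lt_osuccE -db.
  rewrite db; apply: le_trans (Sge b); rewrite pnsS asboolF; last exact: nG'.
  by apply/leoD2r/IH; rewrite // db osucc_gt.
- apply: Ulim => // b bd; have [cb|/ltW/Uhomo bc] := leP c b.
    exact: le_trans (IH b bd cb) (Shomo _ _ (ltW bd)).
  exact: le_trans bc (le_trans cle (Shomo _ _ (ltW cd))).
Qed.

Lemma pns_limit_tail G alpha d : is_limit d -> exists2 c, c < d &
  partial_natural_sum G alpha d = partial_natural_sum (G `&` below c) alpha d.
Proof.
move=> dl; have sT := pns_sumlike set0 alpha; have sS := pns_sumlike G alpha.
have [c [_ cd Tc]] := limit_remainder sT dl (limit_gt0 dl); exists c => //.
have sU := pns_sumlike (G `&` below c) alpha.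
have cE := pns_below G alpha c.
apply/le_anti/andP; split; last first.
  apply: pns_tail_le (ltW cd); last by rewrite cE.
  by move=> b cb [_]; rewrite /below/= ltNge cb.
have [Thomo _ _ _] := sT; have [Uhomo _ _ _] := sU; have [Shomo Slim _ _] := sS.
case: Tc => [Tc|[Tb [e Tc]]].
  (* If the ordinary sums are constant from [c] on, the bound by the value at [c] is obtained as
     growth below [omega^0]. *)
  apply: le_trans (Uhomo _ _ (ltW cd)); rewrite cE -lt_osuccE.
  rewrite -(oadd0 (partial_natural_sum G alpha c)) -oaddS -[osucc ozero]omega_pow0.
  apply: sumlike_growth sS sT (ltW cd) _; rewrite Tc.
  exact/oaddx_gt/omega_pow_gt0.
apply: (@le_trans _ _ (oadd (partial_natural_sum G alpha c) (omega_pow e))).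
  apply: Slim => // b bd; have [/Shomo bc|/ltW cb] := leP b c.
    exact: le_trans bc (leo_addr _ _).
  by apply/ltW/(sumlike_growth sS sT cb); rewrite -Tc; exact: Tb.
(* If the truncated sums grew by less than [omega^e], so would the ordinary sums, which grow by
   exactly that much. *)
rewrite -cE leNgt; apply/negP => /(sumlike_growth sT sU (ltW cd)).
by rewrite Tc ltxx.
Qed.

(** * Shuffles and realizations *)

(** Left subtraction; the default is taken only when [z < x]. *)
Definition osub (z x : Ord) : Ord := xget ozero [set y | z = oadd x y].

Lemma oaddK x y : osub (oadd x y) x = y.
Proof.
apply/esym/(@oaddI x).
exact: (xgetPex ozero (ex_intro (fun w => oadd x y = oadd x w) y erefl)).
Qed.

Lemma lt_oaddP x y z : z < oadd x y ->
  z < x \/ exists2 w, w < y & z = oadd x w.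
Proof. by have [xz /(oadd_ltP xz)|] := leP x z; [right|left]. Qed.

(* [below v] is the disjoint union of the increasing images of [below x] under
   [f] and of [below y] under [g]; the set [C] contains every point of [x]
   in front of which [f] makes room for values of [g]. *)
Record shuffle (x y v : Ord) (f g : Ord -> Ord) (C : set Ord) : Prop := Shuffle {
  shuffle_l : forall a, a < x -> f a < v;
  shuffle_r : forall b, b < y -> g b < v;
  shuffle_lmono : forall a a', a' < x -> a < a' -> f a < f a';
  shuffle_rmono : forall b b', b' < y -> b < b' -> g b < g b';
  shuffle_disj : forall a b, a < x -> b < y -> f a <> g b;
  shuffle_cover : forall w, w < v ->
    (exists2 a, a < x & f a = w) \/ (exists2 b, b < y & g b = w);
  shuffle_fin : finite_set C;
  shuffle_cut : forall a a' w, a' < x -> a < a' -> f a < w -> w < f a' ->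
    (exists2 u, u < x & f u = w) \/ (exists2 c, C c & a < c /\ c <= a') }.

Lemma shuffle0 : shuffle ozero ozero ozero id id set0.
Proof.
have no x : ~ (x < ozero) by rewrite ltNge ozero_le.
split; last 2 first.
- exact: finite_set0.
- by move=> a a' w /no.
- by move=> a /no.
- by move=> b /no.
- by move=> a a' /no.
- by move=> b b' /no.
- by move=> a b /no.
- by move=> w /no.
Qed.

(** The block [p] comes first, then [q], then the given shuffle. The only new cut is in front of the
    point [p], where [q] is inserted; old cuts are shifted by [p]. *)
Lemma shuffle_add p q x y v f g C : shuffle x y v f g C ->
  exists f' g' C', shuffle (oadd p x) (oadd q y) (oadd (oadd p q) v) f' g' C'.
Proof.
move=> [fv gv fm gm fg cov fin cut].
pose f' u := if u < p then u else oadd (oadd p q) (f (osub u p)).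
pose g' u := if u < q then oadd p u else oadd (oadd p q) (g (osub u q)).
have f'l u : u < p -> f' u = u by rewrite /f' => ->.
have f'r u : f' (oadd p u) = oadd (oadd p q) (f u).
  by rewrite /f' ltNge leo_addr oaddK.
have g'l u : u < q -> g' u = oadd p u by rewrite /g' => ->.
have g'r u : g' (oadd q u) = oadd (oadd p q) (g u).
  by rewrite /g' ltNge leo_addr oaddK.
have ppq : p <= oadd p q by exact: leo_addr.
have top z w : z < oadd p q -> z < oadd (oadd p q) w.
  by move=> /lt_le_trans; apply; exact: leo_addr.
exists f', g', (p |` (oadd p @` C)); split.
- move=> u /lt_oaddP[up|[w wx ->]]; last by rewrite f'r ltoD2l fv.
  by rewrite f'l// top// (lt_le_trans up).
- move=> u /lt_oaddP[up|[w wx ->]]; last by rewrite g'r ltoD2l gv.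
  by rewrite g'l// top// ltoD2l.
- move=> u u' /lt_oaddP[u'p|[w' wx' ->]] uu'.
    by rewrite !f'l// (lt_trans uu').
  have [/[dup] up /f'l ->|pu] := ltP u p.
    by rewrite f'r top// (lt_le_trans up).
  by have [w ww' ->] := oadd_ltP pu uu'; rewrite !f'r ltoD2l fm.
- move=> u u' /lt_oaddP[u'p|[w' wx' ->]] uu'.
    by rewrite !g'l ?ltoD2l// (lt_trans uu').
  have [/[dup] up /g'l ->|pu] := ltP u q.
    by rewrite g'r top// ltoD2l.
  by have [w ww' ->] := oadd_ltP pu uu'; rewrite !g'r ltoD2l gm.
- move=> a b /lt_oaddP[ap|[w wx ->]] /lt_oaddP[bq|[w' w'y ->]].
  + rewrite f'l// g'l// => E; move: ap; rewrite E.
    by rewrite ltNge leo_addr.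
  + rewrite f'l// g'r => E; move: ap; rewrite E.
    by rewrite ltNge (le_trans ppq)// leo_addr.
  + rewrite f'r g'l// -oaddA => /oaddI E; move: bq; rewrite -E.
    by rewrite ltNge leo_addr.
  + by rewrite f'r g'r => /oaddI; exact: fg.
- move=> w /lt_oaddP[/lt_oaddP[wp|[u uq ->]]|[u /cov uv ->]].
  + left; exists w; rewrite ?f'l//.
    by apply: lt_le_trans wp _; exact: leo_addr.
  + right; exists u; rewrite ?g'l//.
    by apply: lt_le_trans uq _; exact: leo_addr.
  + case: uv => [[a ax <-]|[b bx <-]]; [left|right].
      by exists (oadd p a); rewrite ?ltoD2l ?f'r.
    by exists (oadd q b); rewrite ?ltoD2l ?g'r.
- by rewrite finite_setU; split; [exact: finite_set1|exact: finite_image].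
- move=> a a' w /lt_oaddP[a'p|[s' s'x ->]] aa'.
    rewrite !f'l//; last exact: lt_trans aa' a'p.
    move=> _ wa'; left; exists w; last by rewrite f'l// (lt_trans wa').
    by apply: lt_le_trans (lt_trans wa' a'p) _; exact: leo_addr.
  have [ap _ _|pa] := ltP a p.
    by right; exists p; [left|split=> //; exact: leo_addr].
  have [s ss' ->] := oadd_ltP pa aa'; rewrite !f'r => sw.
  have pqw : oadd p q <= w by apply: le_trans (ltW sw); exact: leo_addr.
  move=> /(oadd_ltP pqw)[t ts' tE]; move: sw; rewrite tE ltoD2l => st.
  have [[u ux <-]|[c Cc [ac ca']]] := cut s s' t s'x ss' st ts'.
    by left; exists (oadd p u); rewrite ?ltoD2l ?f'r.
  by right; exists (oadd p c); [right; exists c|rewrite ltoD2l leoD2l].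
Qed.

(** Each exponent of the common normal form takes one [shuffle_add], with the terms of [x] and [y]
    as [p] and [q]. *)
Lemma natsum_shuffle x y v : is_natural_sum x y v ->
  exists f g C, shuffle x y v f g C.
Proof.
case=> s [_ -> -> ->]; elim: s => [|[[e m] n] s [f [g [C sh]]]] /=.
  by rewrite !cnf_val_nil; exists id, id, set0; exact: shuffle0.
by rewrite !cnf_val_cons/= omulD; exact: shuffle_add sh.
Qed.

(** * Order types and tame realizations *)

Lemma has_order_type_image (h : Ord -> Ord) (x : Ord) :
  (forall c d, d < x -> c < d -> h c < h d) -> has_order_type (h @` below x) x.
Proof.
move=> hm; exists h; split; last by move=> c d _ dx; exact: hm.
split; first by move=> c cx; exists c.
  move=> c d; rewrite !inE => cx dx hcd.
  by case: (ltgtP c d) => // [/(hm _ _ dx)|/(hm _ _ cx)]; rewrite hcd ltxx.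
by move=> _ [c cx <-]; exists c.
Qed.

Lemma has_order_typeE A x : has_order_type A x -> exists h : Ord -> Ord,
  A = h @` below x /\ forall c d, d < x -> c < d -> h c < h d.
Proof.
case=> h [[hA _ hs] hm]; exists h; split.
  by rewrite predeqE => a; split=> [/hs//|[c cx <-]]; exact: hA.
by move=> c d dx cd; apply: hm => //; exact: lt_trans cd dx.
Qed.

(** The invariant of the induction: the properties sought, with [zeta] and [beta] free to vary. *)
Definition tame (alpha : Ord -> Ord) (zeta beta : Ord) (A : Ord -> set Ord) : Prop :=
  [/\ realizes (below zeta) alpha beta A,
      forall eps : Ord, eps < zeta ->
        finite_set [set gamma : Ord | [/\ gamma < zeta, eps < gamma &
          exists b a, [/\ A gamma b, A eps a & b < a]]] &
      finite_set [set eps : Ord | eps < zeta /\ ~ convex_in beta (A eps)]].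

Lemma tame0 alpha : exists A, tame alpha ozero ozero A.
Proof.
have no x : ~ (x < ozero) by rewrite ltNge ozero_le.
exists (fun=> set0); split=> [||].
- split=> [i j /no//||i /no//].
  by rewrite predeqE => x; split=> [[i /no]//|/no].
- by move=> eps /no.
- by rewrite (_ : [set _ | _] = set0)// predeqE => x; split=> [[/no]|].
Qed.

(** Each new piece is the interval from [U x] to [U (osucc x)]. It is convex and lies above all
    earlier pieces, so no new exceptions arise. *)
Lemma tame_ordinary alpha U c d :
  c <= d -> {homo U : x y / x <= y} ->
  (forall x u, is_limit x -> (forall y, y < x -> U y <= u) -> U x <= u) ->
  (forall x, c <= x -> U (osucc x) = oadd (U x) (alpha x)) ->
  (exists A, tame alpha c (U c) A) -> exists A, tame alpha d (U d) A.
Proof.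
move=> cd Uhomo Ulim US [A [[Atriv Acov Aot] Afin Acvx]].
pose B (x : Ord) : set Ord :=
  if x < c then A x else [set w | U x <= w /\ w < U (osucc x)].
have Bl x : x < c -> B x = A x by rewrite /B => ->.
have Br x : c <= x -> B x = [set w | U x <= w /\ w < U (osucc x)].
  by rewrite /B ltNge => ->.
have Alt x a : x < c -> A x a -> a < U c.
  by move=> xc Axa; have : below (U c) a by rewrite -Acov; exists x.
have Bge x y a b : x < y -> c <= y -> B x a -> B y b -> a < b.
  move=> xy cy; rewrite (Br y cy) => /[swap] -[/= yb _].
  have [xc|cx] := ltP x c; [rewrite Bl// => /(Alt _ _ xc)|rewrite Br// => -[_]] => lt;
    apply: lt_le_trans lt (le_trans _ yb); apply: Uhomo => //.
  by rewrite osucc_leE.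
have Btriv x y a : x < y -> B x a -> B y a -> False.
  move=> xy; have [yc|cy] := ltP y c.
    have xc := lt_trans xy yc; rewrite !Bl// => Axa Aya.
    by move: xy; rewrite (Atriv x y xc yc) ?ltxx//; exists a.
  by move=> Bx By; have := Bge _ _ _ _ xy cy Bx By; rewrite ltxx.
exists B; split.
- split.
  + move=> x y _ _ [a [Bxa Bya]].
    by case: (ltgtP x y) => // [xy|yx]; exfalso;
      [exact: Btriv xy Bxa Bya|exact: Btriv yx Bya Bxa].
  + rewrite predeqE => w; split=> [[x xd]|wd].
      have [xc|cx] := ltP x c.
        rewrite Bl// => /(Alt _ _ xc) wc.
        exact: lt_le_trans wc (Uhomo _ _ cd).
      rewrite Br// => -[_ /= wx]; apply: lt_le_trans wx (Uhomo _ _ _).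
      by rewrite osucc_leE.
    have [wc|cw] := ltP w (U c).
      have [x xc Axw] : (\bigcup_(i in below c) A i) w by rewrite Acov.
      by exists x; rewrite ?Bl//; exact: lt_le_trans xc cd.
    (* The least [x] with [w < U x] is not a limit, by continuity; the piece of its predecessor
       contains [w]. *)
    have [x [wx xmin]] := ord_least (ex_intro (fun x => w < U x) d wd).
    have cx : c < x.
      by rewrite ltNge; apply/negP => /Uhomo xc; move: wx; rewrite ltNge (le_trans xc).
    case: (ord_zsl x) => [x0|[y xy]|xl].
    * by move: cx; rewrite x0 ltNge ozero_le.
    * exists y; first by rewrite /below/= -osucc_leE -xy; exact: xmin.
      rewrite Br; last by rewrite -lt_osuccE -xy.
      split; last by rewrite -xy.
      rewrite leNgt; apply/negP => /xmin; by rewrite xy osucc_leE ltxx.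
    * have : U x <= w; last by rewrite leNgt wx.
      apply: Ulim => // y yx; rewrite leNgt; apply/negP => /xmin.
      by rewrite leNgt yx.
  + move=> x xd; have [xc|cx] := ltP x c; first by rewrite Bl//; exact: Aot.
    rewrite Br// (_ : [set _ | _] = oadd (U x) @` below (alpha x)).
      by apply: has_order_type_image => a b _; rewrite ltoD2l.
    rewrite US// predeqE => w; split=> [[xw /(oadd_ltP xw)[y yx ->]]|[y yx <-]].
      by exists y.
    by rewrite /= leo_addr ltoD2l.
- move=> x xd; have [xc|cx] := ltP x c.
    apply: sub_finite_set (Afin x xc) => y [yd xy [b [a [Byb Bxa ba]]]].
    have [yc|cy] := ltP y c.
      by split=> //; exists b, a; rewrite -!Bl.
    by have := Bge _ _ _ _ xy cy Bxa Byb; rewrite ltNge ltW.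
  rewrite (_ : [set _ | _] = set0)// predeqE => y.
  split=> // -[yd xy [b [a [Byb Bxa ba]]]].
  have cy : c <= y by rewrite ltW// (le_lt_trans cx).
  by have := Bge _ _ _ _ xy cy Bxa Byb; rewrite ltNge ltW.
- apply: sub_finite_set Acvx => x [xd nB].
  have [xc|cx] := ltP x c.
    split=> // Ac; apply: nB => a a'; rewrite Bl// => Aa Aa' aa' b [_ /andP[ab ba']].
    apply: (Ac a a') => //; split; last by rewrite ab.
    exact: lt_trans ba' (Alt _ _ xc Aa').
  case: nB; rewrite Br// => a a' [/= xa _] [_ a'x] aa' b [_ /andP[ab ba']]/=.
  by rewrite (le_trans xa (ltW ab)) (lt_trans ba').
Qed.

(** Old pieces are moved by [f], and the image of [g] is the new piece. As [f] is increasing, only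
    [d] can join the finite sets of later indices. *)
Lemma tame_natsum alpha d beta v : is_natural_sum beta (alpha d) v ->
  (exists A, tame alpha d beta A) -> exists A, tame alpha (osucc d) v A.
Proof.
move=> /natsum_shuffle[f [g [C [fv gv fm gm fg cov fin cut]]]].
move=> [A [[Atriv Acov Aot] Afin Acvx]].
pose B (x : Ord) : set Ord := if x < d then f @` A x else g @` below (alpha d).
have Bl x : x < d -> B x = f @` A x by rewrite /B => ->.
have Br : B d = g @` below (alpha d) by rewrite /B ltxx.
have Alt x a : x < d -> A x a -> a < beta.
  by move=> xd Axa; have : below beta a by rewrite -Acov; exists x.
have finj a b : a < beta -> b < beta -> f a = f b -> a = b.
  move=> ab bb E; case: (ltgtP a b) => // [/(fm _ _ bb)|/(fm _ _ ab)];
  by rewrite E ltxx.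
have flt a b : a < beta -> b < beta -> f a < f b -> a < b.
  move=> ab bb; apply: contraTT; rewrite -!leNgt le_eqVlt.
  by move=> /predU1P[->//|/(fm _ _ ab)/ltW].
have split_d x : x < osucc d -> x < d \/ x = d.
  by rewrite lt_osuccE le_eqVlt => /predU1P[|]; [right|left].
exists B; split.
- split.
  + move=> x y /split_d[xd|->] /split_d[yd|->]//; rewrite ?(Bl x)// ?(Bl y)// ?Br.
    * move=> [_ [[a Axa <-] [b Ayb E]]]; apply: Atriv => //; exists a; split=> //.
      by rewrite -(finj b a)//; [exact: Alt Ayb|exact: Alt Axa].
    * by move=> [_ [[a /(Alt _ _ xd) ab <-] [b ba /esym/fg]]]; case.
    * by move=> [_ [[b ba <-] [a /(Alt _ _ yd) ab /fg]]]; case.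
  + rewrite predeqE => w; split=> [[x /split_d[xd|->]]|/cov[[a ab <-]|[b bb <-]]].
    * by rewrite Bl// => -[a /(Alt _ _ xd) ab <-]; exact: fv.
    * by rewrite Br => -[b bb <-]; exact: gv.
    * have [x xd Axa] : (\bigcup_(i in below d) A i) a by rewrite Acov.
      exists x; first exact: lt_trans xd (osucc_gt d).
      by rewrite Bl//; exists a.
    * by exists d; [exact: osucc_gt|rewrite Br; exists b].
  + move=> x /split_d[xd|->]; last by rewrite Br; apply: has_order_type_image.
    rewrite Bl//; have [h [AE hm]] := has_order_typeE (Aot x xd).
    rewrite AE image_comp; apply: has_order_type_image => a b bx ab /=.
    apply: fm; last exact: hm.
    by apply: (Alt x) => //; rewrite AE; exists b.
- move=> x /split_d[xd|->].
    apply: (@sub_finite_set _ _ ([set d] `|` _)).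
      2: by rewrite finite_setU; split; [exact: finite_set1|exact: Afin xd].
    move=> y [/split_d[yd|->] xy [b [a [Byb Bxa ba]]]]; [right|by left].
    move: Byb Bxa; rewrite !Bl// => -[b' Ab' bE] [a' Aa' aE].
    split=> //; exists b', a'; split=> //.
    by apply: flt; rewrite ?bE ?aE//; [exact: Alt Ab'|exact: Alt Aa'].
  rewrite (_ : [set _ | _] = set0)// predeqE => y; split=> // -[yd dy _].
  by move: yd; rewrite lt_osuccE leNgt dy.
(* Possible exceptions are the new piece, the pieces not convex before and, for each cut point, the
   at most one piece containing it. *)
- apply: (@sub_finite_set _ _ ([set d] `|`
    ([set x | x < d /\ ~ convex_in beta (A x)] `|`
     \bigcup_(c in C) [set x | x < d /\ A x c]))); last first.
    rewrite !finite_setU; split; first exact: finite_set1.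
    split=> //; apply: bigcup_finite => // c _.
    have [[x [xd Axc]]|nx] := pselect (exists x, x < d /\ A x c).
      apply: (@sub_finite_set _ _ [set x]); last exact: finite_set1.
      by move=> y [yd Ayc]; apply: Atriv => //; exists c.
    rewrite (_ : [set _ | _] = set0)// predeqE => x; split=> // xP.
    by apply: nx; exists x.
  move=> x [/split_d[xd|->] nB]; [right|by left].
  have [Ac|nA] := pselect (convex_in beta (A x)); last by left.
  right; apply: contrapT => nC; apply: nB; rewrite Bl//.
  move=> _ _ [a Aa <-] [a' Aa' <-] faa' w [_ /andP[aw wa']].
  have ab := Alt _ _ xd Aa; have a'b := Alt _ _ xd Aa'.
  have aa' := flt _ _ ab a'b faa'.
  (* Either [w] is the image of a point between [a] and [a'], which lies in [A x] by convexity, or a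
     cut point lies above [a] and at most at [a'], hence in [A x], which was excluded. *)
  have [[u ub uE]|[c Cc [ac]]] := cut a a' w a'b aa' aw wa'.
    exists u => //; apply: (Ac a a') => //; split=> //.
    by apply/andP; split; apply: flt => //; rewrite uE.
  rewrite le_eqVlt => /predU1P[cE|ca']; case: nC; exists c => //; split=> //.
    by rewrite cE.
  apply: (Ac a a') => //; split; last by rewrite ac.
  exact: lt_trans ca' a'b.
Qed.

Lemma pns_tame alpha G zeta :
  exists A, tame alpha zeta (partial_natural_sum G alpha zeta) A.
Proof.
elim/ord_ind: zeta => z IH.
(* This serves limits and ordinary successors alike: once [G] may be truncated at [c], all later
   steps are ordinary additions. *)
have ordinary c : c < z ->
    partial_natural_sum G alpha z = partial_natural_sum (G `&` below c) alpha z ->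
    exists A, tame alpha z (partial_natural_sum G alpha z) A.
  move=> cz ->; have [Uhomo Ulim _ _] := pns_sumlike (G `&` below c) alpha.
  apply: (@tame_ordinary _ (partial_natural_sum (G `&` below c) alpha) c) => //.
  - exact: ltW.
  - by move=> x cx; rewrite pnsS asboolF// => -[_]; rewrite /below/= ltNge cx.
  - by rewrite pns_below; exact: IH.
case: (ord_zsl z) => [->|[d zd]|/(pns_limit_tail G alpha)[c]]; last exact: ordinary.
  by rewrite pns0; exact: tame0.
have dz : d < z by rewrite zd osucc_gt.
have [Gd|nGd] := pselect (G d).
  rewrite zd pnsS asboolT//.
  by apply: tame_natsum (natural_sumP _ _) _; exact: IH.
(* As [d] is outside [G], truncating [G] at [d] does not change the sum at the successor of [d]. *)
apply: (ordinary d) => //.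
by rewrite zd !pnsS pns_below !asboolF// => -[].
Qed.

Theorem theorem4p2 (zeta : Ord) (alpha : Ord -> Ord) (G : set Ord)
    (hG : G `<=` below zeta) :
  let beta := partial_natural_sum G alpha zeta in
  mixed_sum (below zeta) alpha beta /\
  exists A : Ord -> set Ord,
    [/\ realizes (below zeta) alpha beta A,
        forall eps : Ord, eps < zeta ->
          finite_set [set gamma : Ord | [/\ gamma < zeta, eps < gamma &
            exists b a, [/\ A gamma b, A eps a & b < a]]] &
        finite_set [set eps : Ord | eps < zeta /\ ~ convex_in beta (A eps)]].
Proof.
move=> beta; have [A tA] := pns_tame alpha G zeta.
by split; exists A => //; have [] := tA.
Qed.
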